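(* (1)(a) For every Stone algebra $\mathcal{S}=(S,\vee,\wedge,\sim,0,1)$ there exists an approximation space $(U,R)$ such that $\mathcal{S}$ can be embedded into the Stone algebra $\mathcal{RS}_{\sim}$ of $(U,R)$. (1)(b) For all $\alpha,\beta\in\mathcal{F}_{\sim}$: $\alpha\vdash_{\mathcal{L}_{S}}\beta$ if and only if $\alpha\vdash\beta$ is valid in the class of all Stone algebras $\mathcal{RS}_{\sim}$, for all approximation spaces $(U,R)$. (2)(a) For every dual Stone algebra $\mathcal{DS}=(DS,\vee,\wedge,\neg,0,1)$ there exists an approximation space $(U,R)$ such that $\mathcal{DS}$ can be embedded into the dual Stone algebra $\mathcal{RS}_{\neg}$ of $(U,R)$. (2)(b) For all $\alpha,\beta\in\mathcal{F}_{\neg}$: $\alpha\vdash_{\mathcal{L}_{DS}}\beta$ if and only if $\alpha\vdash\beta$ is valid in the class of all dual Stone algebras $\mathcal{RS}_{\neg}$, for all approximation spaces $(U,R)$.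
   Context: A Stone algebra is an algebra $(S,\vee,\wedge,\sim,0,1)$ such that $(S,\vee,\wedge,0,1)$ is a bounded distributive lattice, $\sim a=\max\{c\in S: a\wedge c=0\}$ exists for every $a\in S$, and $\sim a\vee\sim\sim a=1$ for all $a$. A dual Stone algebra is an algebra $(D,\vee,\wedge,\neg,0,1)$ such that $(D,\vee,\wedge,0,1)$ is a bounded distributive lattice, $\neg a=\min\{c\in D: a\vee c=1\}$ exists for every $a\in D$, and $\neg a\wedge\neg\neg a=0$ for all $a$. The one-element algebra is allowed. Embeddings preserve all operations, including $0,1$. An approximation space is a pair $(U,R)$ with $U$ a set and $R$ an equivalence relation on $U$; $[x]$ denotes the class of $x$. For $A\subseteq U$, $\mathsf{L}A:=\bigcup\{[x]:[x]\subseteq A\}$ and $\mathsf{U}A:=\bigcup\{[x]:[x]\cap A\ne\emptyset\}$. $\mathcal{RS}:=\{(\mathsf{L}A,\mathsf{U}A):A\subseteq U\}$ is ordered by componentwise inclusion, with componentwise union and intersection as $\vee,\wedge$, bottom $(\emptyset,\emptyset)$, top $(U,U)$. $\mathcal{RS}_{\sim}$ is the Stone algebra formed by $\mathcal{RS}$, with $\sim(\mathsf{L}A,\mathsf{U}A)=((\mathsf{U}A)^{c},(\mathsf{U}A)^{c})$; $\mathcal{RS}_{\neg}$ is the dual Stone algebra formed by $\mathcal{RS}$, with $\neg(\mathsf{L}A,\mathsf{U}A)=((\mathsf{L}A)^{c},(\mathsf{L}A)^{c})$. Formulas $\mathcal{F}_{\sim}$ (resp. $\mathcal{F}_{\neg}$):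 built from propositional variables $p,q,r,\ldots$ and constants $\top,\bot$ with $\vee,\wedge$ and the unary connective $\sim$ (resp. $\neg$). A valuation in an algebra $A$ is a map $v$ from formulas to $A$ preserving $\vee,\wedge$ and the unary connective, with $v(\bot)=0$, $v(\top)=1$. $\alpha\vdash\beta$ is valid in $A$ if $v(\alpha)\le v(\beta)$ for all valuations $v$ in $A$, and valid in a class if valid in each member. BDLL consists of the following postulates and rules (premises / conclusion): $\alpha\vdash\alpha$; $\alpha\vdash\beta,\ \beta\vdash\gamma\,/\,\alpha\vdash\gamma$; $\alpha\wedge\beta\vdash\alpha$, $\alpha\wedge\beta\vdash\beta$; $\alpha\vdash\beta,\ \alpha\vdash\gamma\,/\,\alpha\vdash\beta\wedge\gamma$; $\alpha\vdash\alpha\vee\beta$, $\beta\vdash\alpha\vee\beta$; $\alpha\vdash\gamma,\ \beta\vdash\gamma\,/\,\alpha\vee\beta\vdash\gamma$; $\alpha\wedge(\beta\vee\gamma)\vdash(\alpha\wedge\beta)\vee(\alpha\wedge\gamma)$; $\alpha\vdash\top$; $\bot\vdash\alpha$. $\vdash_{\mathcal{L}_S}$ is the least relation on $\mathcal{F}_{\sim}$ satisfying BDLL together with: $\alpha\vdash\beta\,/\,\sim\beta\vdash\sim\alpha$; $\sim\alpha\wedge\sim\beta\vdash\sim(\alpha\vee\beta)$; $\top\vdash\sim\bot$; $\alpha\wedge\beta\vdash\gamma\,/\,\alpha\wedge\sim\gamma\vdash\sim\beta$; $\alpha\wedge\sim\alpha\vdash\bot$; $\top\vdash\sim\alpha\vee\sim\sim\alpha$.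 $\vdash_{\mathcal{L}_{DS}}$ is the least relation on $\mathcal{F}_{\neg}$ satisfying BDLL together with: $\alpha\vdash\beta\,/\,\neg\beta\vdash\neg\alpha$; $\neg(\alpha\wedge\beta)\vdash\neg\alpha\vee\neg\beta$; $\neg\top\vdash\bot$; $\gamma\vdash\alpha\vee\beta\,/\,\neg\beta\vdash\alpha\vee\neg\gamma$; $\top\vdash\alpha\vee\neg\alpha$; $\neg\alpha\wedge\neg\neg\alpha\vdash\bot$. *)

(* Defs.v *)
From HB Require Import structures.
From mathcomp Require Import all_boot order.
From mathcomp Require Import boolp classical_sets.
From Corelib Require Import RelationClasses.

Set Implicit Arguments.
Unset Strict Implicit.
Unset Printing Implicit Defensive.

Local Open Scope classical_set_scope.

HB.mixin Record TBDistrLattice_isStone (d : Order.disp_t) S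
    of Order.TBDistrLattice d S := {
  pcompl : S -> S;
  pcompl_meet : forall a : S, (a `&` pcompl a = \bot)%O;
  pcompl_max : forall a c : S, (a `&` c = \bot)%O -> (c <= pcompl a)%O;
  pcompl_stone : forall a : S, (pcompl a `|` pcompl (pcompl a) = \top)%O;
}.

#[short(type="stoneType")]
HB.structure Definition Stone (d : Order.disp_t) :=
  { S of TBDistrLattice_isStone d S & Order.TBDistrLattice d S }.

HB.mixin Record TBDistrLattice_isDualStone (d : Order.disp_t) D
    of Order.TBDistrLattice d D := {
  dpcompl : D -> D;
  dpcompl_join : forall a : D, (a `|` dpcompl a = \top)%O;
  dpcompl_min : forall a c : D, (a `|` c = \top)%O -> (dpcompl a <= c)%O;
  dpcompl_stone : forall a : D, (dpcompl a `&` dpcompl (dpcompl a) = \bot)%O;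
}.

#[short(type="dualStoneType")]
HB.structure Definition DualStone (d : Order.disp_t) :=
  { D of TBDistrLattice_isDualStone d D & Order.TBDistrLattice d D }.

(* The type {tblmorphism S -> T} only records preservation of \bot and \top,
   so all the clauses are spelled out here. *)
Definition lattice_embedding d d' (S : tbDistrLatticeType d)
    (T : tbDistrLatticeType d') (f : S -> T) : Prop :=
  [/\ injective f,
      {morph f : x y / (x `|` y)%O},
      {morph f : x y / (x `&` y)%O},
      f \bot%O = \bot%O
    & f \top%O = \top%O].

Definition stone_embedding d d' (S : stoneType d) (T : stoneType d')
    (f : S -> T) : Prop :=
  lattice_embedding f /\ {morph f : x / pcompl x}.

Definition dual_stone_embedding d d' (S : dualStoneType d)
    (T : dualStoneType d') (f : S -> T) : Prop :=
  lattice_embedding f /\ {morph f : x / dpcompl x}.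

Record approx_space := ApproxSpace {
  univ :> Type;
  indisc : univ -> univ -> Prop;
  indisc_equiv : Equivalence indisc;
}.

Definition eqclass (A : approx_space) (x : A) : set A := [set y | indisc x y].

Definition lower (A : approx_space) (B : set A) : set A :=
  \bigcup_(x in [set x | eqclass x `<=` B]) eqclass x.

Definition upper (A : approx_space) (B : set A) : set A :=
  \bigcup_(x in [set x | eqclass x `&` B !=set0]) eqclass x.

Definition rough_pairs (A : approx_space) : set (set A * set A) :=
  range (fun B : set A => (lower B, upper B)).
Arguments rough_pairs : clear implicits.

Definition rough_set (A : approx_space) : Type := set_type (rough_pairs A).

HB.instance Definition _ (A : approx_space) :=
  Choice.copy (rough_set A) (set_type (rough_pairs A)).

Section RoughSets.
Variable A : approx_space.
Implicit Types (x y z : A) (B P Q : set A) (X Y Z : rough_set A).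

Let Rrefl x : indisc x x.
Proof. by have [r _ _] := indisc_equiv A; apply: r. Qed.

Let Rsym x y : indisc x y -> indisc y x.
Proof. by have [_ s _] := indisc_equiv A; apply: s. Qed.

Let Rtrans x y z : indisc x y -> indisc y z -> indisc x z.
Proof. by have [_ _ t] := indisc_equiv A; apply: t. Qed.

Let lowerE B x : lower B x <-> eqclass x `<=` B.
Proof.
split=> [[y yB yx] z xz|xB]; last by exists x => //; exact: Rrefl.
by apply: yB; exact: Rtrans yx xz.
Qed.

Let upperE B x : upper B x <-> exists2 y, indisc x y & B y.
Proof.
split=> [[y [z [yz Bz]] yx]|[y xy By]].
  by exists z => //; exact: Rtrans (Rsym yx) yz.
by exists x; [exists y | exact: Rrefl].
Qed.

Let saturated P := forall x y, indisc x y -> P x -> P y.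

(* (P, Q) is rough iff P and Q are unions of classes, P `<=` Q, and no class
   inside Q \ P is a singleton; conversely B is P plus one point of each class
   inside Q \ P. *)
Let rough P Q := [/\ P `<=` Q, saturated P, saturated Q &
  forall x, Q x -> ~ P x -> exists2 y, indisc x y & y <> x].

Let eqclass_eq x y : indisc x y -> eqclass x = eqclass y.
Proof.
move=> xy; apply/seteqP; split=> z; last exact: Rtrans.
by apply: Rtrans; exact: Rsym.
Qed.

Let eqclass_ne x : exists y, eqclass x y.
Proof. by exists x; exact: Rrefl. Qed.

Let rep x : A := sval (cid (eqclass_ne x)).

Let rep_indisc x : indisc x (rep x).
Proof. by rewrite /rep; case: cid. Qed.

Let rep_eq x y : indisc x y -> rep x = rep y.
Proof.
move=> xy; rewrite /rep; move: (eqclass_ne x) (eqclass_ne y).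
by rewrite (eqclass_eq xy) => p q; rewrite (Prop_irrelevance p q).
Qed.

Let roughP P Q : rough_pairs A (P, Q) <-> rough P Q.
Proof.
split=> [[B _ [<- <-]]|[PQ sP sQ ex]].
  split.
  - by move=> x /lowerE xB; apply/upperE; exists x; [|apply: xB]; exact: Rrefl.
  - by move=> x y xy /lowerE; rewrite (eqclass_eq xy) => ?; apply/lowerE.
  - move=> x y xy /upperE[z xz Bz]; apply/upperE; exists z => //.
    exact: Rtrans (Rsym xy) xz.
  - move=> x /upperE[y xy By] nL; apply: contrapT => nex.
    have all_eq z : indisc x z -> z = x.
      by move=> xz; apply: contrapT => zx; apply: nex; exists z.
    apply: nL; apply/lowerE => z xz.
    by rewrite (all_eq _ xz) -(all_eq _ xy).
exists (P `|` [set x | Q x /\ x = rep x]) => //.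
congr pair; apply/seteqP; split=> x.
- move=> /lowerE xB; apply: contrapT => nPx.
  have nP y : indisc x y -> ~ P y.
    by move=> xy Py; apply: nPx; exact: sP (Rsym xy) Py.
  have eqr y : indisc x y -> y = rep x.
    move=> xy; have [/(nP _ xy)//|[_ ->]] := xB _ xy.
    by rewrite (rep_eq xy).
  have Qx : Q x by have [/nPx//|[]] := xB _ (Rrefl x).
  have [y xy []] := ex _ Qx nPx.
  by rewrite (eqr _ xy) -(eqr _ (Rrefl x)).
- by move=> Px; apply/lowerE => y xy; left; exact: sP xy Px.
- move=> /upperE[y xy [Py|[Qy _]]]; apply: sQ (Rsym xy) _ => //.
  exact: PQ.
- move=> Qx; apply/upperE; exists (rep x); first exact: rep_indisc.
  right; split; first exact: sQ (rep_indisc x) Qx.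
  exact: rep_eq (rep_indisc x).
Qed.

Let roughV X : rough (val X).1 (val X).2.
Proof. by apply/roughP; rewrite -surjective_pairing; exact/set_mem/valP. Qed.

Let rough_join X Y : rough_pairs A
  ((val X).1 `|` (val Y).1, (val X).2 `|` (val Y).2).
Proof.
apply/roughP; have [a b c e] := roughV X; have [a' b' c' e'] := roughV Y.
split.
- exact: setUSS.
- by move=> x y xy [/(b _ _ xy)|/(b' _ _ xy)]; [left|right].
- by move=> x y xy [/(c _ _ xy)|/(c' _ _ xy)]; [left|right].
- by move=> x [Qx|Qx] /not_orP[n n']; [exact: e|exact: e'].
Qed.

Let rough_meet X Y : rough_pairs A
  ((val X).1 `&` (val Y).1, (val X).2 `&` (val Y).2).
Proof.
apply/roughP; have [a b c e] := roughV X; have [a' b' c' e'] := roughV Y.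
split.
- exact: setISS.
- by move=> x y xy [/(b _ _ xy) ? /(b' _ _ xy)].
- by move=> x y xy [/(c _ _ xy) ? /(c' _ _ xy)].
- by move=> x [Qx Qx'] /not_andP[n|n]; [exact: e|exact: e'].
Qed.

Let rough_diag P : saturated P -> rough_pairs A (P, P).
Proof. by move=> sP; apply/roughP; split. Qed.

Let satC P : saturated P -> saturated (~` P).
Proof. by move=> sP x y xy nP Py; apply: nP; exact: sP (Rsym xy) Py. Qed.

Let rough_pcompl X : rough_pairs A (~` (val X).2, ~` (val X).2).
Proof. by apply/rough_diag/satC; have [] := roughV X. Qed.

Let rough_dpcompl X : rough_pairs A (~` (val X).1, ~` (val X).1).
Proof. by apply/rough_diag/satC; have [] := roughV X. Qed.

Let rough_bot : rough_pairs A (set0, set0).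
Proof. exact: rough_diag. Qed.

Let rough_top : rough_pairs A (setT, setT).
Proof. exact: rough_diag. Qed.

Definition rs_le X Y : bool :=
  `[< (val X).1 `<=` (val Y).1 /\ (val X).2 `<=` (val Y).2 >].

Definition rs_join X Y : rough_set A := SigSub (mem_set (rough_join X Y)).
Definition rs_meet X Y : rough_set A := SigSub (mem_set (rough_meet X Y)).
Definition rs_bot : rough_set A := SigSub (mem_set rough_bot).
Definition rs_top : rough_set A := SigSub (mem_set rough_top).
Definition rs_pcompl X : rough_set A := SigSub (mem_set (rough_pcompl X)).
Definition rs_dpcompl X : rough_set A := SigSub (mem_set (rough_dpcompl X)).

Fact rs_display : Order.disp_t. Proof. exact: Order.Disp tt tt. Qed.

Let rs_le_refl : reflexive rs_le.
Proof. by move=> X; apply/asboolP; split. Qed.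

Let rs_eq X Y : (val X).1 = (val Y).1 -> (val X).2 = (val Y).2 -> X = Y.
Proof.
move=> e1 e2; apply: val_inj.
by rewrite [LHS]surjective_pairing e1 e2 -surjective_pairing.
Qed.

Let rs_le_anti : antisymmetric rs_le.
Proof.
by move=> X Y /andP[/asboolP[a b] /asboolP[c e]]; apply: rs_eq; apply/seteqP.
Qed.

Let rs_le_trans : transitive rs_le.
Proof.
move=> Y X Z /asboolP[a b] /asboolP[c e]; apply/asboolP; split.
  exact: subset_trans a c.
exact: subset_trans b e.
Qed.

HB.instance Definition _ := Order.Le_isPOrder.Build rs_display (rough_set A)
  rs_le_refl rs_le_anti rs_le_trans.

Let rs_meetP X Y Z : rs_le X (rs_meet Y Z) = rs_le X Y && rs_le X Z.
Proof.
apply/asboolP/andP => /=; rewrite !subsetI.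
  by move=> [[a b] [c e]]; split; apply/asboolP.
by move=> [/asboolP[a b] /asboolP[c e]].
Qed.

Let rs_joinP X Y Z : rs_le (rs_join X Y) Z = rs_le X Z && rs_le Y Z.
Proof.
apply/asboolP/andP => /=; rewrite !subUset.
  by move=> [[a b] [c e]]; split; apply/asboolP.
by move=> [/asboolP[a b] /asboolP[c e]].
Qed.

HB.instance Definition _ := Order.POrder_MeetJoin_isLattice.Build rs_display
  (rough_set A) rs_meetP rs_joinP.

Let rs_meetUl : left_distributive rs_meet rs_join.
Proof. by move=> X Y Z; apply: rs_eq; exact: setIUl. Qed.

HB.instance Definition _ := Order.Lattice_Meet_isDistrLattice.Build rs_display
  (rough_set A) rs_meetUl.

Let rs_le0x X : rs_le rs_bot X.
Proof. by apply/asboolP; split; exact: sub0set. Qed.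

Let rs_lex1 X : rs_le X rs_top.
Proof. by apply/asboolP; split; exact: subsetT. Qed.

HB.instance Definition _ := Order.hasBottom.Build rs_display (rough_set A)
  rs_le0x.
HB.instance Definition _ := Order.hasTop.Build rs_display (rough_set A)
  rs_lex1.

Let rs_pcompl_meet X : rs_meet X (rs_pcompl X) = rs_bot.
Proof.
have [PQ _ _ _] := roughV X.
apply: rs_eq; last exact: setICr.
by apply/seteqP; split=> // x [/PQ].
Qed.

Let rs_pcompl_max X Y : rs_meet X Y = rs_bot -> rs_le Y (rs_pcompl X).
Proof.
have [PQ _ _ _] := roughV Y.
move=> /(congr1 (fun Z => (val Z).2))/= /seteqP[e _].
apply/asboolP; split=> x /= Yx Xx; apply: (e x); split=> //.
exact: PQ.
Qed.

Let rs_pcompl_stone X : rs_join (rs_pcompl X) (rs_pcompl (rs_pcompl X)) = rs_top.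
Proof. by apply: rs_eq; exact: setUCr. Qed.

HB.instance Definition _ := TBDistrLattice_isStone.Build rs_display
  (rough_set A) rs_pcompl_meet rs_pcompl_max rs_pcompl_stone.

Let rs_dpcompl_join X : rs_join X (rs_dpcompl X) = rs_top.
Proof.
have [PQ _ _ _] := roughV X.
apply: rs_eq; first exact: setUCr.
apply/seteqP; split=> // x _ /=.
by have [/PQ|] := pselect ((val X).1 x); [left|right].
Qed.

Let rs_dpcompl_min X Y : rs_join X Y = rs_top -> rs_le (rs_dpcompl X) Y.
Proof.
have [PQ _ _ _] := roughV Y.
move=> /(congr1 (fun Z => (val Z).1))/= /seteqP[_ e].
by apply/asboolP; split=> x /= nX; have [//|Yx] := e x I => //; exact: PQ.
Qed.

Let rs_dpcompl_stone X :
  rs_meet (rs_dpcompl X) (rs_dpcompl (rs_dpcompl X)) = rs_bot.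
Proof. by apply: rs_eq; exact: setICr. Qed.

HB.instance Definition _ := TBDistrLattice_isDualStone.Build rs_display
  (rough_set A) rs_dpcompl_join rs_dpcompl_min rs_dpcompl_stone.

End RoughSets.

(* The languages F_tilde and F_hook have disjoint unary connectives; the index
   records which one is meant by [Neg]. *)
Variant connective := Tilde | Hook.

Inductive form (c : connective) : Type :=
| Var of nat
| Top
| Bot
| Or of form c & form c
| And of form c & form c
| Neg of form c.

Arguments Var {c}.
Arguments Top {c}.
Arguments Bot {c}.

Record is_valuation (c : connective) d (T : tbDistrLatticeType d)
    (neg : T -> T) (v : form c -> T) : Prop := IsValuation {
  val_or : forall a b, v (Or a b) = (v a `|` v b)%O;
  val_and : forall a b, v (And a b) = (v a `&` v b)%O;
  val_neg : forall a, v (Neg a) = neg (v a);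
  val_bot : v Bot = \bot%O;
  val_top : v Top = \top%O;
}.

Definition stone_valid d (S : stoneType d) (a b : form Tilde) : Prop :=
  forall v : form Tilde -> S, is_valuation (@pcompl d S) v -> (v a <= v b)%O.

Definition dual_stone_valid d (D : dualStoneType d) (a b : form Hook) : Prop :=
  forall v : form Hook -> D, is_valuation (@dpcompl d D) v -> (v a <= v b)%O.

Inductive derivS : form Tilde -> form Tilde -> Prop :=
| S_refl a : derivS a a
| S_trans a b c : derivS a b -> derivS b c -> derivS a c
| S_andEl a b : derivS (And a b) a
| S_andEr a b : derivS (And a b) b
| S_andI a b c : derivS a b -> derivS a c -> derivS a (And b c)
| S_orIl a b : derivS a (Or a b)
| S_orIr a b : derivS b (Or a b)
| S_orE a b c : derivS a c -> derivS b c -> derivS (Or a b) c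
| S_distr a b c : derivS (And a (Or b c)) (Or (And a b) (And a c))
| S_top a : derivS a Top
| S_bot a : derivS Bot a
| S_contra a b : derivS a b -> derivS (Neg b) (Neg a)
| S_negOr a b : derivS (And (Neg a) (Neg b)) (Neg (Or a b))
| S_negBot : derivS Top (Neg Bot)
| S_antilogism a b c :
    derivS (And a b) c -> derivS (And a (Neg c)) (Neg b)
| S_explosion a : derivS (And a (Neg a)) Bot
| S_stone a : derivS Top (Or (Neg a) (Neg (Neg a))).

Inductive derivDS : form Hook -> form Hook -> Prop :=
| DS_refl a : derivDS a a
| DS_trans a b c : derivDS a b -> derivDS b c -> derivDS a c
| DS_andEl a b : derivDS (And a b) a
| DS_andEr a b : derivDS (And a b) b
| DS_andI a b c : derivDS a b -> derivDS a c -> derivDS a (And b c)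
| DS_orIl a b : derivDS a (Or a b)
| DS_orIr a b : derivDS b (Or a b)
| DS_orE a b c : derivDS a c -> derivDS b c -> derivDS (Or a b) c
| DS_distr a b c : derivDS (And a (Or b c)) (Or (And a b) (And a c))
| DS_top a : derivDS a Top
| DS_bot a : derivDS Bot a
| DS_contra a b : derivDS a b -> derivDS (Neg b) (Neg a)
| DS_negAnd a b : derivDS (Neg (And a b)) (Or (Neg a) (Neg b))
| DS_negTop : derivDS (Neg Top) Bot
| DS_antilogism a b c :
    derivDS c (Or a b) -> derivDS (Neg b) (Or a (Neg c))
| DS_excluded_middle a : derivDS Top (Or a (Neg a))
| DS_stone a : derivDS (And (Neg a) (Neg (Neg a))) Bot.

(* Main.v *)
(* The points are the prime filters of the algebra. In a Stone algebra a prime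
   filter contains exactly one of ~x and ~~x, so x |-> (h x, h (~~x)), with h x
   the set of prime filters containing x, is an embedding into pairs of nested
   sets under componentwise operations. Doubling every point into a two-element
   indiscernibility class makes every pair of nested sets a rough set.
   The prime filters only use the order, so the construction applies to a
   preorder. Derivability on formulas is such a preorder, and its representation
   is a canonical countermodel without passing to the Lindenbaum quotient. The
   dual statements follow by reversing the order, through the anti-automorphism
   (P, Q) |-> (~Q, ~P) of the rough sets, induced by complementing A. *)

Require Import Defs.
From mathcomp Require Import all_boot order.
From mathcomp Require Import boolp classical_sets.
From Corelib Require Import RelationClasses.

Set Implicit Arguments.
Unset Strict Implicit.
Unset Printing Implicit Defensive.

Import Order.Theory.

Local Open Scope classical_set_scope.

(** * Stone preorders *)

(** The laws fix the operations only up to mutual [le], so formulas under derivability form an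
    instance. Dual Stone structures are instances with [le] reversed and [join], [meet] and [bot],
    [top] exchanged. *)
Record stone_preorder (T : Type) (le : T -> T -> Prop) (join meet : T -> T -> T)
    (bot top : T) (neg : T -> T) : Prop := StonePreorder {
  sp_refl : forall x, le x x;
  sp_trans : forall y x z, le x y -> le y z -> le x z;
  sp_meetl : forall x y, le (meet x y) x;
  sp_meetr : forall x y, le (meet x y) y;
  sp_meetI : forall x y z, le z x -> le z y -> le z (meet x y);
  sp_joinl : forall x y, le x (join x y);
  sp_joinr : forall x y, le y (join x y);
  sp_joinE : forall x y z, le x z -> le y z -> le (join x y) z;
  sp_distr : forall x y z, le (meet x (join y z)) (join (meet x y) (meet x z));
  sp_bot : forall x, le bot x;
  sp_top : forall x, le x top;
  sp_negI : forall x, le (meet x (neg x)) bot;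
  sp_negmax : forall x y, le (meet x y) bot -> le y (neg x);
  sp_stone : forall x, le top (join (neg x) (neg (neg x)));
}.

(** * Prime filters of a Stone preorder *)

Section PrimeFilters.
Variables (T : Type) (le : T -> T -> Prop) (join meet : T -> T -> T).
Variables (bot top : T) (neg : T -> T).
Hypothesis sp : stone_preorder le join meet bot top neg.
Implicit Types (x y z a b : T) (F : set T).

Let trans := sp_trans sp.

Lemma meet_mono x y x' y' : le x x' -> le y y' -> le (meet x y) (meet x' y').
Proof.
move=> xx yy; apply: (sp_meetI sp) => //.
  exact: (trans (sp_meetl sp _ _) xx).
exact: (trans (sp_meetr sp _ _) yy).
Qed.

Lemma neg_anti x y : le x y -> le (neg y) (neg x).
Proof.
move=> xy; apply: (sp_negmax sp) => //; apply: trans (sp_negI sp y).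
exact: (meet_mono xy (sp_refl sp _)).
Qed.

Lemma neg_join x y : le (meet (neg x) (neg y)) (neg (join x y)).
Proof.
apply: (sp_negmax sp) => //.
set n := meet _ _; have swap u v : le (meet u v) (meet v u).
  exact: (sp_meetI sp (sp_meetr sp _ _) (sp_meetl sp _ _)).
apply: (trans (swap _ _) _); apply: (trans (sp_distr sp _ _ _) _).
apply: (sp_joinE sp) => //; apply: (trans (swap _ _) _).
  apply: trans (sp_negI sp x).
  exact: (meet_mono (sp_refl sp _) (sp_meetl sp _ _)).
apply: trans (sp_negI sp y).
exact: (meet_mono (sp_refl sp _) (sp_meetr sp _ _)).
Qed.

Lemma neg_antilogism x y z : le (meet x y) z -> le (meet x (neg z)) (neg y).
Proof.
move=> xyz; apply: (sp_negmax sp); apply: trans (sp_negI sp z).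
apply: (sp_meetI sp); last exact: (trans (sp_meetr sp _ _) (sp_meetr sp _ _)).
apply: trans xyz; apply: (sp_meetI sp) (sp_meetl sp _ _).
exact: (trans (sp_meetr sp _ _) (sp_meetl sp _ _)).
Qed.

Record filter_set F : Prop := FilterSet {
  filter_up : forall x y, F x -> le x y -> F y;
  filter_meet : forall x y, F x -> F y -> F (meet x y);
}.

Record prime_filter F : Prop := PrimeFilter {
  prime_filter_set : filter_set F;
  prime_top : F top;
  prime_bot : ~ F bot;
  prime_join : forall x y, F (join x y) -> F x \/ F y;
}.

(** Prime filter theorem: Zorn's lemma yields a filter containing [a] and maximal among those
    avoiding [b]; maximality and distributivity make it prime. *)
Lemma prime_filter_exists a b : ~ le a b ->
  exists F, [/\ prime_filter F, F a & ~ F b].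
Proof.
move=> nab.
(* The empty set must be admitted: [Zorn_bigcup] includes the empty chain. *)
pose P F := [/\ filter_set F, ~ F b & forall x, F x -> F a].
have [|M [[Mf Mb Ma] Mmax]] := @Zorn_bigcup T P.
- move=> C CP Ctot; split.
  + split=> [x y [F CF Fx] xy|x y [F CF Fx] [G CG Gy]].
      by exists F => //; have [ff _ _] := CP _ CF; exact: (filter_up ff Fx xy).
    have [ff _ _] := CP _ CF; have [fg _ _] := CP _ CG.
    have [FG|GF] := Ctot _ _ CF CG.
      by exists G => //; apply: filter_meet => //; exact: FG.
    by exists F => //; apply: filter_meet => //; exact: GF.
  + by move=> [F CF]; have [] := CP _ CF.
  + move=> x [F CF Fx]; exists F => //.
    by have [_ _] := CP _ CF; apply; exact: Fx.
have max F x : P F -> M `<=` F -> F x -> M x.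
  move=> PF MF Fx; apply: contrapT => nMx; apply: (Mmax F) => //.
  by split=> // /(_ _ Fx).
(* [M] might still be empty. Adjoining the principal filter of [a] keeps [P], so maximality puts [a]
   in [M]. *)
have Maa : M a.
  apply: (max (fun x => M x \/ le a x)); last by right; exact: (sp_refl sp _).
    split; last by right; exact: (sp_refl sp _).
      split=> [x y [Mx|ax] xy|x y].
      - by left; exact: (filter_up Mf Mx xy).
      - by right; exact: (trans ax xy).
      (* If [a] is in [M], the union is [M] itself; otherwise [M] is empty and the union is the
         principal filter of [a]. *)
      - have [Ma'|nMa] := pselect (M a).
          have H z : M z \/ le a z -> M z.
            by move=> [//|]; exact: (filter_up Mf Ma').
          by move=> /H Mx /H My; left; exact: filter_meet.
        have H z : M z \/ le a z -> le a z by move=> [/Ma|].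
        by move=> /H ax /H ay; right; exact: (sp_meetI sp ax ay).
    by move=> [].
  by move=> x Mx; left.
(* The filter generated by [M] and an [x] outside [M] must contain [b], by maximality. *)
have ext x : ~ M x -> exists2 m, M m & le (meet m x) b.
  move=> nMx; apply: contrapT => nb; apply: nMx.
  apply: (max (fun z => exists2 m, M m & le (meet m x) z)).
  - split=> //.
      split=> [y z [m Mm my] yz|y z [m Mm my] [n Mn nz]].
        by exists m => //; exact: (trans my yz).
      exists (meet m n); first exact: filter_meet.
      apply: (sp_meetI sp) => //.
        by apply: trans my; exact: (meet_mono (sp_meetl sp _ _) (sp_refl sp _)).
      by apply: trans nz; exact: (meet_mono (sp_meetr sp _ _) (sp_refl sp _)).
    by move=> _ _; exists a => //; exact: (sp_meetl sp _ _).
  - by move=> m Mm; exists m => //; exact: (sp_meetl sp _ _).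
  - by exists a => //; exact: (sp_meetr sp _ _).
exists M; split=> //; split=> //.
- exact: (filter_up Mf Maa (sp_top sp _)).
- by move=> M0; apply: Mb; exact: (filter_up Mf M0 (sp_bot sp _)).
(* If both [x] and [y] were missing, [m], [n] with m ∧ x ≤ b and n ∧ y ≤ b would give (m ∧ n) ∧ (x ∨
   y) ≤ b, forcing [b] into [M]. *)
- move=> x y Mxy; apply: contrapT => /not_orP[/ext[m Mm mb] /ext[n Mn nb]].
  apply: Mb; have Mmn := filter_meet Mf (filter_meet Mf Mm Mn) Mxy.
  apply: (filter_up Mf Mmn _); apply: (trans (sp_distr sp _ _ _) _).
  apply: (sp_joinE sp) => //.
    by apply: trans mb; exact: (meet_mono (sp_meetl sp _ _) (sp_refl sp _)).
  by apply: trans nb; exact: (meet_mono (sp_meetr sp _ _) (sp_refl sp _)).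
Qed.

Section Prime.
Variable F : set T.
Hypothesis pF : prime_filter F.

Let up x y : le x y -> F x -> F y.
Proof. by move=> xy Fx; exact: (filter_up (prime_filter_set pF) Fx xy). Qed.

Lemma prime_meetE x y : F (meet x y) <-> F x /\ F y.
Proof.
split=> [Fxy|[]]; last exact: (filter_meet (prime_filter_set pF)).
by split; [exact: (up (sp_meetl sp _ _) Fxy)|exact: (up (sp_meetr sp _ _) Fxy)].
Qed.

Lemma prime_joinE x y : F (join x y) <-> F x \/ F y.
Proof.
split; first exact: prime_join.
by move=> []; [exact: (up (sp_joinl sp _ _))|exact: (up (sp_joinr sp _ _))].
Qed.

Lemma prime_negF x : F x -> ~ F (neg x).
Proof.
move=> Fx Fn; apply: (prime_bot pF); apply: (up (sp_negI sp x) _).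
by apply/prime_meetE.
Qed.

Lemma prime_negnegE x : F (neg (neg x)) <-> ~ F (neg x).
Proof.
split=> [Fnn Fn|nFn]; first exact: (prime_negF Fn Fnn).
by have /prime_joinE[] := up (sp_stone sp x) (prime_top pF).
Qed.

Lemma prime_neg_joinE x y : F (neg (join x y)) <-> F (neg x) /\ F (neg y).
Proof.
split=> [Fn|/prime_meetE].
  split; apply: up Fn; apply: neg_anti.
    exact: (sp_joinl sp _ _).
  exact: (sp_joinr sp _ _).
exact: (up (neg_join x y)).
Qed.

(** This De Morgan law depends on the Stone identity: if neither ~x nor ~y is in [F], then ~~x and
    ~~y are. With n = ~(x ∧ y), y ∧ n ≤ ~x gives ~~x ∧ n ≤ ~y, so [F] would contain both ~y and
    ~~y. *)
Lemma prime_neg_meetE x y : F (neg (meet x y)) <-> F (neg x) \/ F (neg y).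
Proof.
split=> [Fn|[] Fn]; last 2 first.
- by apply: up Fn; apply: neg_anti; exact: (sp_meetl sp _ _).
- by apply: up Fn; apply: neg_anti; exact: (sp_meetr sp _ _).
apply: contrapT => /not_orP[/prime_negnegE Fx /prime_negnegE Fy].
set n := neg (meet x y) in Fn.
have nx : le (meet y n) (neg x).
  apply: (sp_negmax sp) => //; apply: trans (sp_negI sp (meet x y)).
  apply: (sp_meetI sp); last exact: (trans (sp_meetr sp _ _) (sp_meetr sp _ _)).
  exact: (meet_mono (sp_refl sp _) (sp_meetl sp _ _)).
have ny : le (meet (neg (neg x)) n) (neg y).
  apply: (sp_negmax sp) => //; apply: trans (sp_negI sp (neg x)).
  apply: (sp_meetI sp); last exact: (trans (sp_meetr sp _ _) (sp_meetl sp _ _)).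
  by apply: trans nx; exact: (meet_mono (sp_refl sp _) (sp_meetr sp _ _)).
by apply: (prime_negF _ Fy); apply: (up ny _); apply/prime_meetE.
Qed.

End Prime.

End PrimeFilters.

(** * Nested pairs as rough sets on a doubled space *)

Section Doubling.
Variable X : Type.

Definition same_fst (u v : X * bool) := u.1 = v.1.

Lemma same_fst_equiv : Equivalence same_fst.
Proof. by split=> // [u v w]; rewrite /same_fst => -> ->. Qed.

Definition doubled : approx_space := ApproxSpace same_fst_equiv.

Lemma nested_rough (P Q : set X) : P `<=` Q ->
  rough_pairs doubled ([set u : doubled | P u.1], [set u : doubled | Q u.1]).
Proof.
(* Both copies of each point of [P], and the [true] copy of each point of [Q]: the class of x lies
   inside this set iff [P x], as its [false] copy shows, and meets it iff [Q x]. *)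
move=> PQ; exists [set u : doubled | P u.1 \/ Q u.1 /\ u.2] => //.
congr pair; apply/seteqP; split=> -[x i].
- by move=> [[y j] /= H yx]; have [] := H (x, false) yx => [|[]].
- move=> /= Px; exists (x, i) => // -[y j] /= xy; left.
  by rewrite -[y]xy.
- move=> [[y j] /= [[z k] [/= yz Hz] yx]].
  rewrite -[x]yx [y]yz.
  by case: Hz => [/PQ|[]].
- by move=> /= Qx; exists (x, true) => //; exists (x, true); split=> //; right.
Qed.

Definition nested P Q (PQ : P `<=` Q) : rough_set doubled :=
  SigSub (mem_set (nested_rough PQ)).

End Doubling.

(** * Order reversal on rough sets *)

Section RoughSetFacts.
Variable A : approx_space.
Implicit Types (x y : A) (B : set A) (X Y : rough_set A).

Lemma rough_set_eq X Y :
  (val X).1 = (val Y).1 -> (val X).2 = (val Y).2 -> X = Y.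
Proof.
move=> e1 e2; apply: val_inj.
by rewrite [LHS]surjective_pairing e1 e2 -surjective_pairing.
Qed.

Lemma rough_set_leP X Y :
  (X <= Y)%O <-> (val X).1 `<=` (val Y).1 /\ (val X).2 `<=` (val Y).2.
Proof. by split=> /asboolP. Qed.

Lemma lowerC B : lower (~` B) = ~` upper B.
Proof.
have [_ s t] := indisc_equiv A.
apply/seteqP; split=> x.
  move=> [y yB yx] [z [w [zw Bw]] zx]; apply: (yB w) => //.
  exact: (t _ _ _ yx (t _ _ _ (s _ _ zx) zw)).
move=> nU; exists x; last by have [r _ _] := indisc_equiv A; exact: r.
move=> y xy By; apply: nU; exists x; first by exists y.
by have [r _ _] := indisc_equiv A; exact: r.
Qed.

Lemma upperC B : upper (~` B) = ~` lower B.
Proof. by rewrite -[in RHS](setCK B) lowerC setCK. Qed.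

Lemma rough_dual X : rough_pairs A (~` (val X).2, ~` (val X).1).
Proof.
have [B _ E] := set_mem (valP X).
by exists (~` B) => //; rewrite lowerC upperC -E.
Qed.

Definition rs_dual X : rough_set A := SigSub (mem_set (rough_dual X)).

Lemma rs_dual_le X Y : (rs_dual X <= rs_dual Y)%O <-> (Y <= X)%O.
Proof.
rewrite !rough_set_leP /=; split=> -[].
  by move=> /subsetC + /subsetC; rewrite !setCK.
by move=> /subsetC + /subsetC.
Qed.

Lemma rs_dual_join X Y : rs_dual (X `|` Y)%O = (rs_dual X `&` rs_dual Y)%O.
Proof. by apply: rough_set_eq; exact: setCU. Qed.

Lemma rs_dual_meet X Y : rs_dual (X `&` Y)%O = (rs_dual X `|` rs_dual Y)%O.
Proof. by apply: rough_set_eq; exact: setCI. Qed.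

Lemma rs_dual_bot : rs_dual \bot%O = \top%O.
Proof. by apply: rough_set_eq; exact: setC0. Qed.

Lemma rs_dual_top : rs_dual \top%O = \bot%O.
Proof. by apply: rough_set_eq; exact: setCT. Qed.

Lemma rs_dual_pcompl X : rs_dual (pcompl X) = dpcompl (rs_dual X).
Proof. exact: rough_set_eq. Qed.

End RoughSetFacts.

(** * Representation by rough sets *)

(** The reflecting half of [rr_le] gives injectivity for algebras and completeness for the
    logics. *)
Record rough_representation (T : Type) (le : T -> T -> Prop)
    (join meet : T -> T -> T) (bot top : T) (neg : T -> T) (A : approx_space)
    (rneg : rough_set A -> rough_set A) (f : T -> rough_set A) : Prop :=
  RoughRepresentation {
  rr_le : forall x y, (f x <= f y)%O <-> le x y;
  rr_join : forall x y, f (join x y) = (f x `|` f y)%O;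
  rr_meet : forall x y, f (meet x y) = (f x `&` f y)%O;
  rr_bot : f bot = \bot%O;
  rr_top : f top = \top%O;
  rr_neg : forall x, f (neg x) = rneg (f x);
}.

Section Representation.
Variables (T : Type) (le : T -> T -> Prop) (join meet : T -> T -> T).
Variables (bot top : T) (neg : T -> T).

Lemma stone_representation : stone_preorder le join meet bot top neg ->
  exists (A : approx_space) (f : T -> rough_set A),
    rough_representation le join meet bot top neg (@pcompl _ _) f.
Proof.
move=> sp; pose X := {F : set T | prime_filter le join meet bot top F}.
pose L x : set X := [set F | sval F x].
(* By [prime_negnegE] this is the set of prime filters containing ~~x; in this form the De Morgan
   laws for [neg] apply directly. *)
pose U x : set X := [set F | ~ sval F (neg x)].
have LU x : L x `<=` U x by move=> [F pF] /=; exact: (prime_negF sp pF).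
exists (doubled X), (fun x => nested (LU x)); split.
- move=> x y; rewrite rough_set_leP; split=> [[/= LL _]|xy].
    (* The lower components alone reflect the order: a prime filter separating [x] from [y] refutes
       [LL], and either copy of it would do. *)
    apply: contrapT => /(prime_filter_exists sp)[F [pF Fx]]; apply.
    exact: (LL (exist _ F pF, true)).
  split=> -[[F pF] i] /=.
    by move=> Fx; exact: (filter_up (prime_filter_set pF) Fx xy).
  move=> nFx Fy; apply: nFx; have xy' := neg_anti sp xy.
  exact: (filter_up (prime_filter_set pF) Fy xy').
- move=> x y; apply: rough_set_eq; apply/seteqP.
    by split=> -[[F pF] i] /(prime_joinE sp pF).
  split=> -[[F pF] i] /=; rewrite /U /= (prime_neg_joinE sp pF).
    by move=> /not_andP.
  by move=> H; apply/not_andP.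
- move=> x y; apply: rough_set_eq; apply/seteqP.
    by split=> -[[F pF] i] /(prime_meetE sp pF).
  split=> -[[F pF] i] /=; rewrite /U /= (prime_neg_meetE sp pF).
    by move=> /not_orP.
  by move=> H; apply/not_orP.
- have L0 : L bot = set0.
    by apply/seteqP; split=> -[F pF] //; exact: (prime_bot pF).
  have U0 : U bot = set0.
    apply/seteqP; split=> -[F pF] //=; apply.
    apply: (filter_up (prime_filter_set pF) (prime_top pF) _).
    by apply: (sp_negmax sp) => //; exact: (sp_meetl sp _ _).
  by apply: rough_set_eq => /=; rewrite ?L0 ?U0.
- have LT : L top = setT.
    by apply/seteqP; split=> -[F pF] // _; exact: (prime_top pF).
  have UT : U top = setT.
    by apply/seteqP; split=> // F _; apply: LU; rewrite LT.
  by apply: rough_set_eq => /=; rewrite ?LT ?UT.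
(* Both components of the image of [neg x] must be the complement of [U x], since [pcompl] has equal
   components. *)
- have LN x : L (neg x) = ~` U x.
    by apply/seteqP; split=> -[F pF] /=; rewrite /U /= ?notK // => /contrapT.
  have UN x : U (neg x) = ~` U x.
    by apply/seteqP; split=> -[F pF] /=; rewrite /U /= (prime_negnegE sp pF).
  by move=> x; apply: rough_set_eq => /=; rewrite ?LN ?UN.
Qed.

End Representation.

Lemma dual_stone_representation (T : Type) (le : T -> T -> Prop)
    (join meet : T -> T -> T) (bot top : T) (neg : T -> T) :
  stone_preorder (fun x y => le y x) meet join top bot neg ->
  exists (A : approx_space) (f : T -> rough_set A),
    rough_representation le join meet bot top neg (@dpcompl _ _) f.
Proof.
move=> sp; have [A [f [fle fj fm fb ft fn]]] := stone_representation sp.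
exists A, (fun x => rs_dual (f x)); split=> [x y|x y|x y|||x].
- by rewrite rs_dual_le fle.
- by rewrite fm rs_dual_meet.
- by rewrite fj rs_dual_join.
- by rewrite ft rs_dual_top.
- by rewrite fb rs_dual_bot.
- by rewrite fn rs_dual_pcompl.
Qed.

(** * Algebras and derivability as Stone preorders *)

Lemma stone_algebra_preorder d (S : stoneType d) :
  stone_preorder (fun x y : S => (x <= y)%O) Order.join Order.meet
    \bot%O \top%O pcompl.
Proof.
split=> [x|y x z|x y|x y|x y z zx zy|x y|x y|x y z xz yz|x y z|x|x|x|x y xy|x].
- exact: lexx.
- exact: le_trans.
- exact: leIl.
- exact: leIr.
- by rewrite lexI zx.
- exact: leUl.
- exact: leUr.
- by rewrite leUx xz.
- by rewrite meetUr.
- exact: le0x.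
- exact: lex1.
- by rewrite pcompl_meet.
- by apply: pcompl_max; apply/eqP; rewrite -lex0.
- by rewrite pcompl_stone.
Qed.

Lemma dual_stone_algebra_preorder d (D : dualStoneType d) :
  stone_preorder (fun x y : D => (y <= x)%O) Order.meet Order.join
    \top%O \bot%O dpcompl.
Proof.
split=> [x|y x z|x y|x y|x y z zx zy|x y|x y|x y z xz yz|x y z|x|x|x|x y xy|x].
- exact: lexx.
- by move=> /[swap]; exact: le_trans.
- exact: leUl.
- exact: leUr.
- by rewrite leUx zx.
- exact: leIl.
- exact: leIr.
- by rewrite lexI xz.
- by rewrite joinIr.
- exact: lex1.
- exact: le0x.
- by rewrite dpcompl_join.
- by apply: dpcompl_min; apply/eqP; rewrite -le1x.
- by rewrite dpcompl_stone.
Qed.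

Lemma derivS_preorder : stone_preorder derivS (@Or _) (@And _) Bot Top (@Neg _).
Proof.
split; try by [constructor].
- by move=> y x z; exact: S_trans.
(* Antilogism with [Bot] as its conclusion turns y ∧ x ⊢ ⊥ into y ∧ ~⊥ ⊢ ~x, and y ⊢ ~⊥ holds
   through ⊤. *)
- move=> x y xy; apply: S_trans (S_antilogism _).
    by apply: S_andI (S_refl _) (S_trans (S_top _) S_negBot).
  exact: S_trans (S_andI (S_andEr _ _) (S_andEl _ _)) xy.
Qed.

Lemma derivDS_preorder :
  stone_preorder (fun a b => derivDS b a) (@And _) (@Or _) Top Bot (@Neg _).
Proof.
split; try by [constructor].
- by move=> y x z /[swap]; exact: DS_trans.
(* Read in the reversed order, the goal is (a ∨ b) ∧ (a ∨ c) ⊢ a ∨ (b ∧ c); it follows by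
   distributing over a ∨ c, then over a ∨ b. *)
- move=> a b c; set m := And _ _.
  have swap x y : derivDS (And x y) (And y x).
    exact: DS_andI (DS_andEr _ _) (DS_andEl _ _).
  apply: DS_trans (DS_distr _ _ _) _; apply: DS_orE.
    exact: DS_trans (DS_andEr _ _) (DS_orIl _ _).
  apply: DS_trans (swap _ _) _; apply: DS_trans (DS_distr _ _ _) _.
  apply: DS_orE; first exact: DS_trans (DS_andEr _ _) (DS_orIl _ _).
  exact: DS_trans (swap _ _) (DS_orIr _ _).
(* Dual antilogism with [Top] as premise turns ⊤ ⊢ y ∨ x into ¬x ⊢ y ∨ ¬⊤, and ¬⊤ ⊢ ⊥ removes the
   second disjunct. *)
- move=> x y xy; apply: (@DS_trans _ (Or y (Neg Top))).
    apply: DS_antilogism; apply: DS_trans xy _.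
    exact: DS_orE (DS_orIr _ _) (DS_orIl _ _).
  exact: DS_orE (DS_refl _) (DS_trans DS_negTop (DS_bot _)).
Qed.

(** * Soundness and completeness *)

Lemma derivS_sound d (S : stoneType d) a b : derivS a b -> stone_valid S a b.
Proof.
move=> ab v [vor vand vneg vbot vtop]; have sp := stone_algebra_preorder S.
elim: ab => {a b} [a|a b c _ ab _ bc|a b|a b|a b c _ ab _ ac|a b|a b
  |a b c _ ac _ bc|a b c|a|a|a b _ ab|a b||a b c _ abc|a|a];
  rewrite ?(vor, vand, vneg, vbot, vtop).
- exact: (sp_refl sp).
- exact: (sp_trans sp ab bc).
- exact: (sp_meetl sp).
- exact: (sp_meetr sp).
- exact: (sp_meetI sp ab ac).
- exact: (sp_joinl sp).
- exact: (sp_joinr sp).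
- exact: (sp_joinE sp ac bc).
- exact: (sp_distr sp).
- exact: (sp_top sp).
- exact: (sp_bot sp).
- exact: (neg_anti sp ab).
- exact: (neg_join sp).
- exact: (sp_negmax sp (sp_meetl sp _ _)).
- by apply: (neg_antilogism sp); rewrite -vand.
- exact: (sp_negI sp).
- exact: (sp_stone sp).
Qed.

Lemma derivDS_sound d (D : dualStoneType d) a b :
  derivDS a b -> dual_stone_valid D a b.
Proof.
move=> ab v [vor vand vneg vbot vtop]; have sp := dual_stone_algebra_preorder D.
elim: ab => {a b} [a|a b c _ ab _ bc|a b|a b|a b c _ ab _ ac|a b|a b
  |a b c _ ac _ bc|a b c|a|a|a b _ ab|a b||a b c _ abc|a|a];
  rewrite ?(vor, vand, vneg, vbot, vtop).
- exact: (sp_refl sp).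
- exact: (sp_trans sp bc ab).
- exact: (sp_joinl sp).
- exact: (sp_joinr sp).
- exact: (sp_joinE sp ab ac).
- exact: (sp_meetl sp).
- exact: (sp_meetr sp).
- exact: (sp_meetI sp ac bc).
(* The distributive postulate is not order-reversed in this logic, so it is not an instance of
   [sp_distr] here and is taken from the lattice itself. *)
- by rewrite meetUr.
- exact: (sp_bot sp).
- exact: (sp_top sp).
- exact: (neg_anti sp ab).
- exact: (neg_join sp).
- exact: (sp_negmax sp (sp_meetl sp _ _)).
- by apply: (neg_antilogism sp); rewrite -vor.
- exact: (sp_negI sp).
- exact: (sp_stone sp).
Qed.

(** The representing map on formulas is itself a valuation, so validity in its one target algebra
    already yields a derivation through [fle]. *)
Lemma derivS_complete a b :
  (forall A : approx_space, stone_valid (rough_set A) a b) -> derivS a b.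
Proof.
have [A [f [fle fj fm fb ft fn]]] := stone_representation derivS_preorder.
by move=> /(_ A f) ab; apply/fle/ab; split.
Qed.

Lemma derivDS_complete a b :
  (forall A : approx_space, dual_stone_valid (rough_set A) a b) -> derivDS a b.
Proof.
have [A [f [fle fj fm fb ft fn]]] := dual_stone_representation derivDS_preorder.
by move=> /(_ A f) ab; apply/fle/ab; split.
Qed.

Lemma order_reflecting_inj d d' (S : porderType d) (T : porderType d')
    (f : S -> T) : (forall x y, (f x <= f y)%O <-> (x <= y)%O) -> injective f.
Proof.
by move=> fle x y fxy; apply: le_anti; apply/andP; split; apply/fle;
  rewrite fxy.
Qed.

Theorem theorem10 :
  ((forall (d : Order.disp_t) (S : stoneType d),
      exists (A : approx_space) (f : S -> rough_set A), stone_embedding f) /\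
   (forall a b : form Tilde,
      derivS a b <->
      forall A : approx_space, stone_valid (rough_set A) a b)) /\
  ((forall (d : Order.disp_t) (D : dualStoneType d),
      exists (A : approx_space) (f : D -> rough_set A),
        dual_stone_embedding f) /\
   (forall a b : form Hook,
      derivDS a b <->
      forall A : approx_space, dual_stone_valid (rough_set A) a b)).
Proof.
split; split=> [d S|a b].
- have [A [f [fle fj fm fb ft fn]]] :=
    stone_representation (stone_algebra_preorder S).
  by exists A, f; split=> //; split=> //; exact: order_reflecting_inj fle.
- by split=> [ab A|]; [exact: derivS_sound|exact: derivS_complete].
- have [A [f [fle fj fm fb ft fn]]] :=
    dual_stone_representation (dual_stone_algebra_preorder S).
  by exists A, f; split=> //; split=> //; exact: order_reflecting_inj fle.
- by split=> [ab A|]; [exact: derivDS_sound|exact: derivDS_complete].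
Qed.
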